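(* Let $\mathcal S=(\mathcal U,\tilde\varphi,(\iota^{(i)})_{i\ge1})$ be a spreadability system for a $\mathcal B$-valued noncommutative probability space $(\mathcal A,\varphi)$, let $n\in\mathbb N$ and $X_1,\dots,X_n\in\mathcal A$. For any ordered set partitions $\rho\le\pi$ in $\mathcal{OP}_n$ and any numbers $N_1,N_2,\ldots\in\mathbb N$, with $\underline N=(N_1,N_2,\dots)$, $$\varphi_\rho(N_{\pi(1)}.X_1,\dots,N_{\pi(n)}.X_n)=\sum_{\sigma\in\mathcal{OP}_n,\ \sigma\le\rho}\varphi_\sigma(X_1,\dots,X_n)\,\gamma_{\underline N}(\sigma,\rho,\pi).$$ In particular, for $\rho=\pi$, $$\varphi_\pi(N_{\pi(1)}.X_1,\dots,N_{\pi(n)}.X_n)=\sum_{\sigma\le\pi}\varphi_\sigma(X_1,\dots,X_n)\,\beta_{\underline N}(\sigma,\pi),$$ and this is a polynomial in $N_1,\dots,N_{|\pi|}$ without constant term. Furthermore, in the case $N:=N_1=N_2=\cdots$, $$\varphi_\pi(N.X_1,\dots,N.X_n)=\sum_{\sigma\le\pi}\varphi_\sigma(X_1,\dots,X_n)\,\beta_N(\sigma,\pi),$$ which is a polynomial in $N$ consisting of monomials of degree at least $|\pi|$.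
   Context: Ordered set partitions. $\mathbb N=\{1,2,\dots\}$, $[n]=\{1,\dots,n\}$. An ordered set partition of $[n]$ is a sequence $\pi=(P_1,\dots,P_p)$ of pairwise disjoint nonempty blocks with union $[n]$; $|\pi|=p$; $\mathcal{OP}_n$ is the set of them; $\pi(i)$ denotes the index $k$ with $i\in P_k$; $\bar\pi$ is the underlying (unordered) set partition; set partitions are ordered by refinement. For $\pi=(P_1,\dots,P_p)$, $\sigma=(S_1,\dots,S_s)$ we write $\pi\le\sigma$ iff $\bar\pi\le\bar\sigma$ (each block of $\pi$ lies in a block of $\sigma$) and, whenever $i<j$, $P_i\subseteq S_k$, $P_j\subseteq S_l$, one has $k\le l$. The quasi-meet is $\pi\curlywedge\sigma=(P_1\cap S_1,P_1\cap S_2,\dots,P_1\cap S_s,P_2\cap S_1,\dots,P_p\cap S_s)$ with empty sets removed. The ordered kernel $\kappa(i_1,\dots,i_n)\in\mathcal{OP}_n$ has as blocks the level sets $\{k:i_k=v\}$ listed in increasing order of $v$. For $P\subseteq[n]$ nonempty, $\sigma\rfloor_P$ is the sequence $(P\cap S_1,\dots,P\cap S_s)$ with empty sets removed and $\#(\sigma\rfloor_P)$ its number of blocks. Coefficients. For $\sigma\le\rho\le\pi=(P_1,\dots,P_p)$ and $\underline t=(t_1,t_2,\dots)$: $\beta_{\underline t}(\sigma,\pi)=\prod_{i=1}^p\binom{t_i}{\#(\sigma\rfloor_{P_i})}$, $\beta_t=\beta_{(t,t,\dots)}$, and $\gamma_{\underline t}(\sigma,\rho,\pi)=\prod_{i=1}^p\prod_{R\in\rho,\,R\subseteq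 P_i}\binom{t_i}{\#(\sigma\rfloor_R)}$ (generalized binomial coefficients). Spreadability systems. Algebras are associative over $\mathbb C$. A $\mathcal B$-valued noncommutative probability space is an algebra $\mathcal A$ with a linear map $\varphi:\mathcal A\to\mathcal B$ into an algebra $\mathcal B$. A spreadability system for it is a triple $(\mathcal U,\tilde\varphi,(\iota^{(i)})_{i\ge1})$ with $\mathcal U$ an algebra, $\tilde\varphi:\mathcal U\to\mathcal B$ linear, $\iota^{(i)}:\mathcal A\to\mathcal U$ homomorphisms with $\varphi=\tilde\varphi\circ\iota^{(i)}$, such that, writing $X^{(i)}=\iota^{(i)}(X)$, $\tilde\varphi(X_1^{(i_1)}\cdots X_n^{(i_n)})=\tilde\varphi(X_1^{(h(i_1))}\cdots X_n^{(h(i_n))})$ for all $X_k\in\mathcal A$, $i_k\in\mathbb N$ and all $h:\{i_1,\dots,i_n\}\to\mathbb N$ with $i_p<i_q\Rightarrow h(i_p)<h(i_q)$. For $\pi\in\mathcal{OP}_n$, $\varphi_\pi(X_1,\dots,X_n):=\tilde\varphi(X_1^{(i_1)}\cdots X_n^{(i_n)})$ for any indices with $\kappa(i_1,\dots,i_n)=\pi$; one extends $\varphi_\pi(X_1^{(i_1)},\dots,X_n^{(i_n)}):=\varphi_{\pi\curlywedge\kappa(i_1,\dots,i_n)}(X_1,\dots,X_n)$ and $\varphi_\pi(M_1.X_1,\dots,M_n.X_n):=\sum_{i_1=1}^{M_1}\cdots\sum_{i_n=1}^{M_n}\varphi_\pi(X_1^{(i_1)},\dots,X_n^{(i_n)})$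 for $M_k\in\mathbb N$. *)

(* Defs.v *)
From HB Require Import structures.
From mathcomp Require Import all_boot all_order all_algebra.
From mathcomp Require Import reals complex.

Set Implicit Arguments.
Unset Strict Implicit.
Unset Printing Implicit Defensive.

Import GRing.Theory.
Local Open Scope ring_scope.

(* Algebras are associative but need not have a unit, and homomorphisms need   *)
(* not preserve a unit when there is one: MathComp's algType is too            *)
(* restrictive for this.                                                       *)
HB.mixin Record isNuAlgebra (K : pzRingType) (A : Type) of GRing.Lmodule K A := {
  numul : A -> A -> A;
  numulA : associative numul;
  numulDl : left_distributive numul +%R;
  numulDr : right_distributive numul +%R;
  numulZl : forall (a : K) (x y : A), numul (a *: x) y = a *: numul x y;
  numulZr : forall (a : K) (x y : A), numul x (a *: y) = a *: numul x y
}.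

#[short(type="nuAlgType")]
HB.structure Definition NuAlgebra (K : pzRingType) :=
  {A of isNuAlgebra K A & GRing.Lmodule K A}.

(* x_1 x_2 ... x_m for m >= 1; the value 0 on the empty sequence is a dummy.   *)
Definition nuprod (K : pzRingType) (A : nuAlgType K) (s : seq A) : A :=
  if s is x :: s' then foldl numul x s' else 0.


(* The blocks are the terms of s, as subsets of [n] with [n] taken to be 'I_n. *)
Definition is_osp (n : nat) (s : seq {set 'I_n}) : bool :=
  [&& all (fun P : {set 'I_n} => P != set0) s,
      pairwise (fun P Q : {set 'I_n} => [disjoint P & Q]) s
    & \bigcup_(P <- s) P == [set: 'I_n]].

Record osp (n : nat) : predArgType :=
  Osp { blocks :> seq {set 'I_n}; ospP : is_osp blocks }.

HB.instance Definition _ n := [isSub for @blocks n].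
HB.instance Definition _ n := [Countable of osp n by <:].

Lemma osp_size_le n (s : osp n) : (size s <= n)%N.
Proof.
case: s => s /= /and3P[s0 sD _].
suff: (size s <= #|\bigcup_(P <- s) P|)%N.
  by move/leq_trans; apply; rewrite -[X in (_ <= X)%N]card_ord max_card.
elim: s s0 sD => [|P s IH] //= /andP[P0 s0] /andP[Ps sD].
rewrite big_cons cardsU.
have -> : P :&: \bigcup_(Q <- s) Q = set0.
  apply/eqP; rewrite setI_eq0; elim: s Ps {IH s0 sD} => [|Q s IHs] /=.
    by rewrite big_nil disjoints_subset setC0 subsetT.
  move=> /andP[PQ Ps]; rewrite big_cons disjoint_sym disjoints_subset subUset.
  by rewrite -!disjoints_subset ![[disjoint _ & P]]disjoint_sym PQ IHs.
by rewrite cards0 subn0 -add1n leq_add ?IH ?card_gt0.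
Qed.

Definition osp_bseq n (s : osp n) : n.-bseq {set 'I_n} := Bseq (osp_size_le s).
Definition bseq_osp n (s : n.-bseq {set 'I_n}) : option (osp n) := insub (val s).

Lemma osp_bseqK n : pcancel (@osp_bseq n) (@bseq_osp n).
Proof. by move=> s; rewrite /bseq_osp /= valK. Qed.

HB.instance Definition _ n : isFinite (osp n) := PCanIsFinite (@osp_bseqK n).

(* pi(i): the (1-based) position of the block containing i. *)
Definition block_index n (p : osp n) (i : 'I_n) : nat :=
  (find (fun P : {set 'I_n} => i \in P) p).+1.

(* The refinement order on the underlying unordered set partitions. *)
Definition refines n (p s : osp n) : bool :=
  all (fun P : {set 'I_n} => has (fun S : {set 'I_n} => P \subset S) s) p.

Definition osp_le n (p s : osp n) : bool :=
  refines p s &&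
  [forall i : 'I_(size p), forall j : 'I_(size p),
   forall k : 'I_(size s), forall l : 'I_(size s),
     [&& (i < j)%N, nth set0 p i \subset nth set0 s k
       & nth set0 p j \subset nth set0 s l] ==> (k <= l)%N].

Definition qmeet_seq n (p s : seq {set 'I_n}) : seq {set 'I_n} :=
  [seq Q <- [seq P :&: T | P <- p, T <- s] | Q != set0].

Lemma pairwise_disjointP n (s : seq {set 'I_n}) :
  reflect (forall i, (count (fun P : {set 'I_n} => i \in P) s <= 1)%N)
          (pairwise (fun P Q : {set 'I_n} => [disjoint P & Q]) s).
Proof.
apply: (iffP idP) => [|].
  elim: s => [|P s IH] //= /andP[Ps /IH sD] i.
  case iP: (i \in P); last exact: sD.
  rewrite add1n ltnS leqn0 -[_ == 0%N]negbK -lt0n -has_count -all_predC.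
  apply: sub_all Ps => Q /pred0P/(_ i) /=.
  by rewrite iP /= => ->.
elim: s => [|P s IH] //= h; apply/andP; split; last first.
  by apply: IH => i; apply: leq_trans (h i); rewrite leq_addl.
apply/allP => Q Qs; apply/pred0P => i /=; apply/negP => /andP[iP iQ].
have := h i; rewrite iP add1n ltnS leqn0 => /eqP c0.
have : has (fun P : {set 'I_n} => i \in P) s by apply/hasP; exists Q.
by rewrite has_count c0.
Qed.

Lemma is_ospP n (s : seq {set 'I_n}) :
  reflect (all (fun P : {set 'I_n} => P != set0) s /\
           forall i, count (fun P : {set 'I_n} => i \in P) s = 1%N)
          (is_osp s).
Proof.
have cupE i : (i \in \bigcup_(P <- s) P) =
              (0 < count (fun P : {set 'I_n} => i \in P) s)%N.
  elim: s => [|P s IH]; first by rewrite big_nil inE.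
  by rewrite big_cons inE IH /=; case: (i \in P).
apply: (iffP and3P) => [[h0 /pairwise_disjointP h1 /eqP h2]|[h0 h1]].
  split=> // i; apply/eqP; rewrite eqn_leq h1 /= -cupE h2 inE //.
split=> //; first by apply/pairwise_disjointP => i; rewrite h1.
by apply/eqP/setP => i; rewrite cupE h1 inE.
Qed.

Lemma qmeet_subproof n (p s : osp n) : is_osp (qmeet_seq p s).
Proof.
apply/is_ospP; split=> [|i]; first exact: filter_all.
have /is_ospP[_ /(_ i) cp1] := ospP p; have /is_ospP[_ /(_ i) cs1] := ospP s.
rewrite /qmeet_seq count_filter.
rewrite (eq_count (a2 := fun P : {set 'I_n} => i \in P)); last first.
  move=> P /=; case iP: (i \in P) => //=.
  by apply/set0Pn; exists i.
rewrite -[RHS]cp1; elim: {cp1} (blocks p) => [|P q IH] //=.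
rewrite count_cat IH; congr (_ + _)%N; rewrite count_map.
case iP: (i \in P) => /=.
  by rewrite -[RHS]cs1; apply: eq_count => S /=; rewrite inE iP.
by rewrite -(count_pred0 s); apply: eq_count => S /=; rewrite inE iP.
Qed.

Definition qmeet n (p s : osp n) : osp n := Osp (qmeet_subproof p s).

Definition okernel_seq n (i : 'I_n -> nat) : seq {set 'I_n} :=
  [seq [set k | i k == v] | v <- sort leq (undup (codom i))].

Lemma okernel_subproof n (i : 'I_n -> nat) : is_osp (okernel_seq i).
Proof.
apply/is_ospP; split=> [|k].
  apply/allP => P /mapP[v]; rewrite mem_sort mem_undup => /codomP[k ->] ->.
  by apply/set0Pn; exists k; rewrite inE.
rewrite count_map (eq_count (a2 := pred1 (i k))); last first.
  by move=> v /=; rewrite inE eq_sym.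
by rewrite count_uniq_mem ?sort_uniq ?undup_uniq // mem_sort mem_undup codom_f.
Qed.

Definition okernel n (i : 'I_n -> nat) : osp n := Osp (okernel_subproof i).

Definition restr n (s : seq {set 'I_n}) (P : {set 'I_n}) : seq {set 'I_n} :=
  [seq Q <- [seq P :&: T | T <- s] | Q != set0].


Definition gbinom (K : fieldType) (t : K) (k : nat) : K :=
  (\prod_(j < k) (t - j%:R)) / (k`!)%:R.

(* The sequence (t_1, t_2, ...) is a function on nat whose value at 0 is unused. *)
Definition beta (K : fieldType) n (t : nat -> K) (s p : osp n) : K :=
  \prod_(i < size p) gbinom (t i.+1) (size (restr s (nth set0 p i))).

Definition gamma (K : fieldType) n (t : nat -> K) (s r p : osp n) : K :=
  \prod_(i < size p) \prod_(R <- r | R \subset nth set0 p i)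
    gbinom (t i.+1) (size (restr s R)).


(* Indices range over {1, 2, ...}: only linearity is required of [ss_iota 0]. *)
Record spreadability_system (K : pzRingType) (A B : nuAlgType K)
    (phi : {linear A -> B}) := SpreadabilitySystem {
  ss_alg : nuAlgType K;
  ss_phi : {linear ss_alg -> B};
  ss_iota : nat -> {linear A -> ss_alg};
  ss_iotaM : forall i (x y : A), (0 < i)%N ->
    ss_iota i (numul x y) = numul (ss_iota i x) (ss_iota i y);
  ss_phi_iota : forall i (x : A), (0 < i)%N -> ss_phi (ss_iota i x) = phi x;
  ss_spread : forall (n : nat) (X : 'I_n -> A) (i : 'I_n -> nat)
      (h : nat -> nat),
    (forall k, (0 < i k)%N) -> (forall k, (0 < h (i k))%N) ->
    (forall p q, (i p < i q)%N -> (h (i p) < h (i q))%N) ->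
    ss_phi (nuprod [seq ss_iota (i k) (X k) | k <- enum 'I_n]) =
    ss_phi (nuprod [seq ss_iota (h (i k)) (X k) | k <- enum 'I_n])
}.

Section Phi.
Variables (K : pzRingType) (A B : nuAlgType K) (phi : {linear A -> B}).
Variables (S : spreadability_system phi) (n : nat).
Implicit Types (p : osp n) (i : 'I_n -> nat) (X : 'I_n -> A).

Definition phi_idx i X : B :=
  ss_phi S (nuprod [seq ss_iota S (i k) (X k) | k <- enum 'I_n]).

(* The indices i_k = pi(k) have ordered kernel pi (okernel_block_index), and   *)
(* any other choice gives the same value (phi_opE).                            *)
Definition phi_op p X : B := phi_idx (block_index p) X.

(* phi_pi(X_1^(i_1), ..., X_n^(i_n)) *)
Definition phi_ext p i X : B := phi_op (qmeet p (okernel i)) X.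

(* phi_pi(M_1.X_1, ..., M_n.X_n); the 0-based j k < M k stands for the index   *)
(* i_k = j k + 1 in {1, ..., M_k}.                                             *)
Definition phi_dot p (M : 'I_n -> nat) X : B :=
  \sum_(j : {dffun forall k : 'I_n, 'I_(M k)})
    phi_ext p (fun k => (j k).+1) X.

Lemma block_index_okernel i k :
  block_index (okernel i) k = (index (i k) (sort leq (undup (codom i)))).+1.
Proof.
congr _.+1; rewrite /= /okernel_seq find_map; apply: eq_find => v /=.
by rewrite inE eq_sym.
Qed.

Lemma phi_opE p i X :
  (forall k, (0 < i k)%N) -> okernel i = p -> phi_op p X = phi_idx i X.
Proof.
move=> i0 <-; rewrite /phi_op /phi_idx; symmetry.
pose s := sort leq (undup (codom i)).
rewrite (@ss_spread _ _ _ _ S n X i (fun v => (index v s).+1)) //.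
  by congr (ss_phi _ (nuprod _)); apply: eq_map => k; rewrite block_index_okernel.
move=> a b ab; have ins c : i c \in s by rewrite mem_sort mem_undup codom_f.
rewrite ltnS ltnNge; apply/negP => le_ba.
have sS : sorted leq s by apply: sort_sorted; exact: leq_total.
have := sorted_leq_nth leq_trans leqnn 0%N sS (index (i b) s) (index (i a) s).
rewrite !inE !index_mem !ins => /(_ isT isT le_ba).
by rewrite !nth_index // leqNgt ab.
Qed.

End Phi.

Lemma okernel_block_index n (p : osp n) : okernel (block_index p) = p.
Proof.
have /is_ospP[p0 p1] := ospP p.
have has_p k : has (fun P : {set 'I_n} => k \in P) p by rewrite has_count p1.
have findE k j : (j < size p)%N -> k \in nth set0 p j ->
    find (fun P : {set 'I_n} => k \in P) p = j.
  move=> jp kj; set f := find _ _.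
  have fp : (f < size p)%N by rewrite -has_find.
  have kf : k \in nth set0 p f by apply: (nth_find set0 (has_p k)).
  have /and3P[_ /(pairwiseP set0) pD _] := ospP p.
  case: (ltngtP f j) => // lt_fj.
    by have /pred0P/(_ k) /= := pD f j fp jp lt_fj; rewrite kf kj.
  by have /pred0P/(_ k) /= := pD j f jp fp lt_fj; rewrite kf kj.
have sE : sort leq (undup (codom (block_index p))) = iota 1 (size p).
  apply: (sorted_eq leq_trans anti_leq); first exact: sort_sorted leq_total _.
    exact: iota_sorted.
  rewrite perm_sort; apply: uniq_perm; rewrite ?undup_uniq ?iota_uniq // => v.
  rewrite mem_undup mem_iota add1n ltnS; apply/codomP/idP => [[k ->]|].
    by rewrite /block_index /= -has_find.
  case: v => // j /= jp; have /set0Pn[k kj] := all_nthP set0 p0 j jp.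
  by exists k; rewrite /block_index (findE k j).
apply: val_inj; rewrite /= /okernel_seq sE.
apply: (@eq_from_nth _ set0); rewrite size_map size_iota // => j jp.
rewrite (nth_map 0%N) ?size_iota // nth_iota // add1n.
apply/setP => k; rewrite inE eqSS; apply/eqP/idP => [<-|]; last exact: findE.
exact: (nth_find set0 (has_p k)).
Qed.


(* Value at x of the polynomial in m variables, of degree at most d in each of *)
(* them, whose coefficient at x^e is c e.                                      *)
Definition vmpoly_eval (K : comPzRingType) (V : lmodType K) (m d : nat)
    (c : {ffun 'I_m -> 'I_d.+1} -> V) (x : 'I_m -> K) : V :=
  \sum_(e : {ffun 'I_m -> 'I_d.+1}) (\prod_(i < m) x i ^+ e i) *: c e.

Definition vpoly_eval (K : pzRingType) (V : lmodType K) (d : nat)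
    (c : 'I_d.+1 -> V) (x : K) : V :=
  \sum_(e < d.+1) x ^+ e *: c e.

(* Main.v *)
Require Import Defs.
From mathcomp Require Import all_boot all_order all_algebra.
From mathcomp Require Import reals complex.

Set Implicit Arguments.
Unset Strict Implicit.
Unset Printing Implicit Defensive.

Import GRing.Theory Num.Theory.
Local Open Scope ring_scope.

(** Expanding the dots, the left-hand side is a sum over index functions
    [j : 'I_n -> nat], with [j k] below [N] of the block of [p] containing [k],
    of the terms [phi_op (rho qmeet okernel j)].  The identity follows by
    grouping the [j] according to the ordered set partition [sigma] that
    the quasi-meet produces; what has to be understood is which [sigma] occur
    and how often.

    An ordered set partition is a total preorder on the ground set (two functions have the
    same ordered kernel iff they induce the same order, [okernel_eqP]).  In
    these terms [sigma <= rho] says that [block_index rho] is nondecreasing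
    along the preorder of [sigma] ([osp_leP]), and the quasi-meet is the
    lexicographic preorder ([qmeet_okernel], [lex_code_leq]).  So only
    [sigma <= rho] occur, and for such a [sigma] the quasi-meet of [rho] with
    the kernel of [j] is [sigma] iff, inside each block [P] of [rho], [j] is
    ordered as the blocks of [sigma] are ([qmeet_okernel_eqP]).  There are no
    conditions between different blocks of [rho], because [rho] already decides
    how their elements compare.

    On a single block [P] whose elements fall into [k] blocks of [sigma], such a
    [j] is determined by its set of values, which can be any [k]-element set of
    admissible indices.  All elements of [P] have the same bound [N_i] since
    [rho <= p], so the number of choices is the binomial coefficient of [N_i]
    and [k], and the product over [P] ([card_fibrewise_ordered]) is the
    coefficient [gamma].

    For [rho = p] the coefficient is [beta], a product over the blocks of [p] of
    binomial coefficients with lower entry at least 1.  As polynomials these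
    have degree bounded by [n] and no constant term, which gives both
    polynomiality statements: in several variables the constant term vanishes,
    and when all variables are equal every one of the [size p] factors
    contributes a factor of the variable ([coef_prod_low]). *)

(** * Ranks of the values of a function *)

Section Values.
Variable T : eqType.
Implicit Types (f g : T -> nat) (e : seq T).

Definition values f e : seq nat := sort leq (undup (map f e)).

(** Up to a shift by one this is the block index in the ordered kernel, with
    the domain restricted to the list [e] so that it can be used blockwise. *)
Definition value_rank f e a : nat := index (f a) (values f e).

Definition same_order_on e f g :=
  {in e &, forall a b, (f a <= f b)%N = (g a <= g b)%N}.

Lemma mem_values f e v : (v \in values f e) = (v \in map f e).
Proof. by rewrite mem_sort mem_undup. Qed.

Lemma values_sorted f e : sorted ltn (values f e).
Proof.
by rewrite ltn_sorted_uniq_leq sort_uniq undup_uniq sort_sorted //; exact: leq_total.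
Qed.

Lemma eq_sorted_ltn s1 s2 : sorted ltn s1 -> sorted ltn s2 -> s1 =i s2 -> s1 = s2.
Proof. by apply: irr_sorted_eq; [exact: ltn_trans | exact: ltnn]. Qed.

Lemma nth_sorted_leq s i j : sorted ltn s -> (i < size s)%N -> (j < size s)%N ->
  (nth 0%N s i <= nth 0%N s j)%N = (i <= j)%N.
Proof.
move=> sS si sj; have H := sorted_ltn_nth ltn_trans 0%N sS.
case: (ltngtP i j) => [ij|ji|->]; last exact: leqnn.
  by rewrite ltnW ?H.
by apply/negbTE; rewrite -ltnNge H.
Qed.

Lemma value_rank_lt f e a : a \in e -> (value_rank f e a < size (values f e))%N.
Proof. by move=> ae; rewrite index_mem mem_values map_f. Qed.

Lemma nth_value_rank f e a : a \in e ->
  nth 0%N (values f e) (value_rank f e a) = f a.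
Proof. by move=> ae; rewrite nth_index // mem_values map_f. Qed.

Lemma value_rank_leq f e : {in e &, forall a b,
  (value_rank f e a <= value_rank f e b)%N = (f a <= f b)%N}.
Proof.
move=> a b ae be; rewrite -(nth_sorted_leq (values_sorted f e)) ?value_rank_lt //.
by rewrite !nth_value_rank.
Qed.

Lemma value_rank_onto f e i : (i < size (values f e))%N ->
  exists2 a, a \in e & value_rank f e a = i.
Proof.
move=> ie; have : nth 0%N (values f e) i \in values f e by rewrite mem_nth.
rewrite mem_values => /mapP[a ae fa]; exists a => //.
by rewrite /value_rank -fa index_uniq // sort_uniq undup_uniq.
Qed.

(** The map sending [f a] to [g a] is well defined and increasing, hence it
    carries the increasing enumeration of the values of [f] to that of [g]. *)
Lemma same_order_values f g e : same_order_on e f g ->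
  exists2 h : nat -> nat, {in e, forall a, g a = h (f a)}
                        & values g e = map h (values f e).
Proof.
case: e => [|x e] fg; first by exists id.
move: (x :: e) fg => {}e fg.
have fgE : {in e &, forall a b, f a = f b -> g a = g b}.
  by move=> a b ae be /eqP; rewrite eqn_leq !fg // -eqn_leq => /eqP.
pose h v := g (nth x e (index v (map f e))).
have hE : {in e, forall a, g a = h (f a)}.
  move=> a ae; have fae : f a \in map f e by apply: map_f.
  have ie : (index (f a) (map f e) < size e)%N by rewrite -(size_map f) index_mem.
  by apply: fgE => //; rewrite ?mem_nth // -(nth_map x 0%N) // nth_index.
exists h => //; apply: eq_sorted_ltn; first exact: values_sorted.
  apply: (homo_sorted_in (P := mem (values f e)) _ _ (values_sorted f e)).
    move=> v w; rewrite /= !mem_values => /mapP[a ae ->] /mapP[b be ->].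
    by rewrite -!hE // !ltnNge fg.
  by apply/allP.
move=> v; rewrite mem_values; apply/mapP/mapP => -[a ae ->].
  by exists (f a); rewrite ?hE // mem_values map_f.
by move: ae; rewrite mem_values => /mapP[b be ->]; exists b; rewrite ?hE.
Qed.

Lemma size_same_order_values f g e : same_order_on e f g ->
  size (values f e) = size (values g e).
Proof. by move=> /same_order_values[h _ ->]; rewrite size_map. Qed.

(** An increasing change of values moves no position in the sorted list.
    Together with [nth_value_rank], a function is thus recovered from the order
    it induces and its set of values. *)
Lemma same_order_value_rank f g e : same_order_on e f g ->
  {in e, value_rank f e =1 value_rank g e}.
Proof.
move=> fg a ae; have gf : same_order_on e g f by move=> ? ? ? ?; rewrite fg.
have [h hE vE] := same_order_values fg.
have la := value_rank_lt f ae.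
have : nth 0%N (values g e) (value_rank f e a) = g a.
  by rewrite vE (nth_map 0%N) // nth_value_rank // hE.
move=> ga; rewrite [RHS]/value_rank -ga index_uniq ?(sort_uniq, undup_uniq) //.
by rewrite -(size_same_order_values fg).
Qed.

End Values.

(** * Ordered set partitions as preorders *)

Section Preorder.
Variable n : nat.
Implicit Types (p s r : osp n) (f g : 'I_n -> nat).

Lemma block_index_le p k : (block_index p k <= size p)%N.
Proof.
have /is_ospP[_ p1] := ospP p.
by rewrite /block_index -has_find has_count p1.
Qed.

Lemma mem_block p j k : (j < size p)%N ->
  (k \in nth set0 p j) = (block_index p k == j.+1).
Proof.
move=> jp; have /is_ospP[_ p1] := ospP p.
have hp : has (fun P : {set 'I_n} => k \in P) p by rewrite has_count p1.
apply/idP/eqP => [kj|[<-]]; last exact: (nth_find set0 hp).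
have /and3P[_ /(pairwiseP set0) pD _] := ospP p.
have kf := nth_find set0 hp; have fp := block_index_le p k.
rewrite /block_index in fp *; congr _.+1.
case: (ltngtP (find (fun P : {set 'I_n} => k \in P) p) j) => // lt_fj.
  by have /pred0P/(_ k) /= := pD _ _ fp jp lt_fj; rewrite kf kj.
by have /pred0P/(_ k) /= := pD _ _ jp fp lt_fj; rewrite kf kj.
Qed.

Lemma block_exists p j : (j < size p)%N -> exists k, block_index p k = j.+1.
Proof.
move=> jp; have /is_ospP[p0 _] := ospP p.
have /set0Pn[k kj] := all_nthP set0 p0 j jp.
by exists k; apply/eqP; rewrite -mem_block.
Qed.

Lemma blocksE p :
  p = [seq [set k | block_index p k == v] | v <- iota 1 (size p)] :> seq _.
Proof.
apply: (@eq_from_nth _ set0) => [|j jp]; first by rewrite size_map size_iota.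
rewrite (nth_map 0%N) ?size_iota // nth_iota // add1n.
by apply/setP => k; rewrite inE mem_block.
Qed.

Lemma block_indexE f k :
  block_index (okernel f) k = (value_rank f (enum 'I_n) k).+1.
Proof. exact: block_index_okernel. Qed.

(** Lets the kernel be read off from any increasing list of candidate values, in
    particular from the rectangle of pairs of block indices. *)
Lemma okernel_seq_filter f vs :
    sorted ltn vs -> {subset codom f <= vs} ->
  [seq Q <- [seq [set k | f k == v] | v <- vs] | Q != set0] = okernel_seq f.
Proof.
move=> vsS fvs; rewrite filter_map; congr (map _ _).
apply: eq_sorted_ltn; first by rewrite sorted_filter //; exact: ltn_trans.
  exact: values_sorted.
move=> v; rewrite mem_filter mem_sort mem_undup /=.
apply/andP/idP => [[/set0Pn[k]]|vf].
  by rewrite inE => /eqP <- _; exact: codom_f.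
split; last exact: fvs.
by have /codomP[k ->] := vf; apply/set0Pn; exists k; rewrite inE.
Qed.

(** An ordered set partition is the same thing as a total preorder on its
    ground set; this is how all equalities between them are decided below. *)
Lemma okernel_eqP f g :
  reflect (forall a b, (f a <= f b)%N = (g a <= g b)%N) (okernel f == okernel g).
Proof.
apply: (iffP eqP) => [fg a b | fg].
  have rk (h : 'I_n -> nat) c d : (h c <= h d)%N =
      (block_index (okernel h) c <= block_index (okernel h) d)%N.
    by rewrite !block_indexE ltnS value_rank_leq ?mem_enum.
  by rewrite rk fg -rk.
apply: val_inj => /=.
have [h hE vE] : exists2 h : nat -> nat, {in enum 'I_n, forall a, g a = h (f a)}
    & values g (enum 'I_n) = map h (values f (enum 'I_n)).
  by apply: same_order_values => a b _ _.
rewrite /okernel_seq -![sort leq _]/(values _ (enum 'I_n)) vE -map_comp.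
apply/eq_in_map => v; rewrite mem_values => /mapP[b _ ->].
apply/setP => a; rewrite !inE /= -hE ?mem_enum //.
by rewrite !eqn_leq !fg.
Qed.

(** Blocks of the quasi-meet are listed lexicographically, so it is the kernel
    of a positional encoding of the pair of block indices. *)
Definition lex_code p s k : nat :=
  (block_index p k * (size s).+1 + block_index s k)%N.

Lemma qmeet_okernel p s : qmeet p s = okernel (lex_code p s).
Proof.
apply: val_inj; rewrite /= /qmeet_seq {1}(blocksE p) {1}(blocksE s).
set m := (size s).+1.
rewrite allpairs_mapl allpairs_mapr.
pose vs := [seq (u * m + v)%N | u <- iota 1 (size p), v <- iota 1 (size s)].
have -> : [seq [set k | block_index p k == u] :&: [set k | block_index s k == v]
            | u <- iota 1 (size p), v <- iota 1 (size s)] =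
          [seq [set k | lex_code p s k == w] | w <- vs].
  rewrite map_allpairs; apply/eq_in_allpairs => u v _.
  rewrite mem_iota add1n ltnS => /andP[_ vs_le].
  apply/setP => k; rewrite !inE /lex_code -/m.
  apply/andP/eqP => [[/eqP-> /eqP->] //|E].
  have sm : (block_index s k < m)%N by rewrite ltnS block_index_le.
  have := congr1 (divn^~ m) E; have := congr1 (modn^~ m) E.
  rewrite !modnMDl !divnMDl // !modn_small ?ltnS // !divn_small ?ltnS //.
  by rewrite !addn0 => -> ->.
apply: okernel_seq_filter.
  (* The codes increase along the rectangle of pairs, read row by row. *)
  rewrite sorted_pairwise; last exact: ltn_trans.
  rewrite {}/vs; have : sorted ltn (iota 1 (size p)) by apply: iota_ltn_sorted.
  rewrite sorted_pairwise; last exact: ltn_trans.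
  elim: (iota 1 (size p)) => [//|u l IH].
  rewrite [pairwise _ (u :: l)]/= => /andP[ul /IH lS].
  rewrite allpairs_cons pairwise_cat lS andbT; apply/andP; split.
    apply/allrelP => x y /mapP[v + ->] /allpairsP[[u' v'] /= [u'l _ ->]].
    rewrite mem_iota add1n ltnS => /andP[_ vs_le].
    have /(_ u' u'l) := allP ul; rewrite /= => uu'.
    apply: (@leq_trans (u.+1 * m)); first by rewrite mulSn addnC ltn_add2r ltnS.
    by apply: leq_trans (leq_addr _ _); rewrite leq_mul2r uu' orbT.
  rewrite pairwise_map; have := iota_ltn_sorted 1 (size s).
  rewrite sorted_pairwise; last exact: ltn_trans.
  by apply: sub_pairwise => x y /=; rewrite ltn_add2l.
move=> w /codomP[k ->]; apply/allpairsP.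
exists (block_index p k, block_index s k) => /=.
by rewrite !mem_iota !add1n !ltnS !block_index_le.
Qed.

Lemma lex_code_leq p s a b : (lex_code p s a <= lex_code p s b)%N =
  (block_index p a < block_index p b)%N ||
  (block_index p a == block_index p b) && (block_index s a <= block_index s b)%N.
Proof.
rewrite /lex_code; have := block_index_le s a; have := block_index_le s b.
move: (block_index s a) (block_index s b) (block_index p a) (block_index p b).
move=> x y u v; rewrite -[(y <= _)%N]ltnS -[(x <= _)%N]ltnS; set m := (size s).+1 => ym xm.
have lt c d z w : (z < m)%N -> (c < d)%N -> (c * m + z < d * m + w)%N.
  move=> zm cd; apply: (@leq_trans (c.+1 * m)); first by rewrite mulSn addnC ltn_add2r.
  by apply: leq_trans (leq_addr _ _); rewrite leq_mul2r cd orbT.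
case: (ltngtP u v) => [uv|vu|->] /=; last by rewrite leq_add2l.
  by apply: ltnW; apply: lt.
by apply/negbTE; rewrite -ltnNge; apply: lt.
Qed.

(** The two halves of the order, refinement and compatibility with the listing
    of blocks, are monotonicity applied to elements of one block of [s] and of
    two different ones. *)
Lemma osp_leP s p :
  reflect (forall a b, (block_index s a <= block_index s b)%N ->
                       (block_index p a <= block_index p b)%N)
          (osp_le s p).
Proof.
have memb r k : exists2 j : 'I_(size r), k \in nth set0 r j & block_index r k = j.+1.
  have kr := block_index_le r k; exists (Ordinal kr) => //=.
  by rewrite mem_block.
apply: (iffP andP) => [[/allP ref ord] a b|mon].
  have [i ai iE] := memb s a; have [j bj jE] := memb s b.
  have [k ak kE] := memb p a; have [l bl lE] := memb p b.
  have sub x (c : 'I_(size s)) (d : 'I_(size p)) :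
      x \in nth set0 s c -> x \in nth set0 p d -> nth set0 s c \subset nth set0 p d.
    move=> xc xd; have /hasP[P /(nthP set0)[e ep <-] ce] := ref _ (mem_nth set0 (ltn_ord c)).
    have := subsetP ce _ xc; rewrite mem_block // => /eqP xe.
    by move: xd; rewrite mem_block // xe => /eqP[<-].
  rewrite iE jE kE lE !ltnS leq_eqVlt => /orP[/eqP ij|ij].
    have := subsetP (sub b _ _ bj bl) a; rewrite -ij => /(_ ai).
    by rewrite mem_block // kE => /eqP[->].
  move/forallP/(_ i)/forallP/(_ j)/forallP/(_ k)/forallP/(_ l)/implyP: ord.
  by apply; rewrite ij (sub a) // (sub b).
split.
  apply/allP => Q /(nthP set0)[j js <-]; have [a aj] := block_exists js.
  have [k ak kE] := memb p a; apply/hasP; exists (nth set0 p k); first exact: mem_nth.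
  apply/subsetP => b; rewrite !mem_block // -aj -kE => /eqP ba.
  by rewrite eqn_leq !mon // ba.
apply/'forall_forallP => i j; apply/'forall_forallP => k l.
apply/implyP => /and3P[ij ik jl].
have [a ai] := block_exists (ltn_ord i); have [b bj] := block_exists (ltn_ord j).
have := subsetP ik a; have := subsetP jl b.
rewrite !mem_block // ai bj !eqxx => /(_ isT)/eqP bl /(_ isT)/eqP ak.
by rewrite -ltnS -ak -bl mon // ai bj ltnS ltnW.
Qed.

Lemma qmeet_le p s : osp_le (qmeet p s) p.
Proof.
apply/osp_leP => a b; rewrite qmeet_okernel !block_indexE ltnS.
rewrite value_rank_leq ?mem_enum // lex_code_leq => /orP[/ltnW //|/andP[/eqP-> //]].
Qed.

(** Elements in different blocks of [p] compare the same way in [s] and in the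
    quasi-meet, namely as their blocks do, which leaves one condition per block
    of [p]. *)
Lemma qmeet_okernel_eqP p s f : osp_le s p ->
  reflect (forall a b, block_index p a = block_index p b ->
             (f a <= f b)%N = (block_index s a <= block_index s b)%N)
          (qmeet p (okernel f) == s).
Proof.
move=> /osp_leP sp; rewrite qmeet_okernel -[X in _ == X]okernel_block_index.
have fE a b : (block_index (okernel f) a <= block_index (okernel f) b)%N =
              (f a <= f b)%N.
  by rewrite !block_indexE ltnS value_rank_leq ?mem_enum.
apply: (iffP (okernel_eqP _ _)) => [H a b ab|H a b].
  by rewrite -H lex_code_leq ab ltnn eqxx fE.
rewrite lex_code_leq fE; case: (ltngtP (block_index p a) (block_index p b)) => /=.
- move=> ab; symmetry; have [//|/ltnW/sp] := leqP (block_index s a) (block_index s b).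
  by rewrite leqNgt ab.
- move=> ba; symmetry; apply/negbTE/negP => /sp; by rewrite leqNgt ba.
- exact: H.
Qed.

Lemma size_restr s (P : {set 'I_n}) :
  size (restr s P) = size (values (block_index s) (enum P)).
Proof.
rewrite /restr filter_map size_map {1}(blocksE s) filter_map size_map.
congr (size _); apply: eq_sorted_ltn.
- by rewrite sorted_filter ?iota_ltn_sorted //; exact: ltn_trans.
- exact: values_sorted.
move=> v; rewrite mem_filter mem_values mem_iota add1n ltnS /=.
apply/andP/mapP => [[/set0Pn[k]]|[k]].
  by rewrite !inE => /andP[kP /eqP <-] _; exists k; rewrite ?mem_enum.
rewrite mem_enum => kP ->; split; last by rewrite block_index_le.
by apply/set0Pn; exists k; rewrite !inE kP eqxx.
Qed.

Lemma size_restr_gt0 s (P : {set 'I_n}) : P != set0 -> (0 < size (restr s P))%N.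
Proof.
move=> /set0Pn[k kP]; rewrite size_restr.
by apply: leq_ltn_trans (value_rank_lt (block_index s) (_ : k \in enum P)); rewrite ?mem_enum.
Qed.

End Preorder.

(** * Counting functions with prescribed order on each fibre *)

Section FibrewiseCount.
Variables (T I : finType) (b : T -> I) (f : T -> nat) (m : I -> nat).
(* The bounds are given pointwise, and only propositionally constant on fibres,
   because the functions counted have a codomain depending on the point. *)
Variable M : T -> nat.
Hypothesis ME : forall x, M x = m (b x).

Local Notation bounded := {dffun forall x : T, 'I_(M x)}.

Let fibre i := enum [pred x | b x == i].

Let in_fibre x : x \in fibre (b x).
Proof. by rewrite mem_enum inE. Qed.

Definition fibrewise_ordered (j : T -> nat) :=
  [forall x, forall y, (b x == b y) ==> ((j x <= j y)%N == (f x <= f y)%N)].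

Lemma fibrewise_orderedP (j : T -> nat) :
  reflect (forall x y, b x = b y -> (j x <= j y)%N = (f x <= f y)%N)
          (fibrewise_ordered j).
Proof.
apply: (iffP 'forall_forallP) => H x y.
  by move=> bxy; have := H x y; rewrite bxy eqxx => /eqP.
by apply/implyP => /eqP bxy; apply/eqP/H.
Qed.

Let fibrewise_same_orderP (j : T -> nat) :
  reflect (forall i, same_order_on (fibre i) j f) (fibrewise_ordered j).
Proof.
apply: (iffP (fibrewise_orderedP j)) => [H i x y|H x y bxy].
  by rewrite !mem_enum !inE => /eqP <- /eqP byx; apply: H.
by apply: (H (b x)); rewrite mem_enum inE ?bxy.
Qed.

(** The conditions on different fibres are independent, and on one fibre such a
    function is the increasing enumeration of its image, composed with the rank
    of [f]; so these functions correspond to families of sets of prescribed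
    sizes. *)
Lemma card_fibrewise_ordered :
  #|[set j : bounded | fibrewise_ordered (fun x => j x)]| =
  (\prod_i 'C(m i, size (values f (fibre i))))%N.
Proof.
pose mm := \max_i m i.
have m_le i : (m i <= mm)%N by apply: leq_bigmax.
have jlt (j : bounded) x : (j x < m (b x))%N.
  by rewrite -ME; exact: ltn_ord.
pose below i := [set v : 'I_mm | v < m i]%N.
have card_below i : #|below i| = m i.
  have wI : injective (widen_ord (m_le i)).
    by move=> v w /(congr1 val) /= /val_inj.
  rewrite -[RHS]card_ord -(card_imset _ wI).
  apply: eq_card => v; rewrite inE; apply/idP/imsetP => [vm|[w _ ->]]; last exact: (ltn_ord w).
  by exists (Ordinal vm) => //; apply: val_inj.
pose F i := [set A : {set 'I_mm} | A \subset below i & #|A| == size (values f (fibre i))].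
have cardF : #|family (fun i => mem (F i))| =
    (\prod_i 'C(m i, size (values f (fibre i))))%N.
  rewrite card_family foldrE big_image; apply: eq_bigr => i _ /=.
  by rewrite -[#|_|]/#|F i| cards_draws card_below.
pose im (j : bounded) : {ffun I -> {set 'I_mm}} :=
  [ffun i => [set v : 'I_mm | [exists x, (b x == i) && (j x == v :> nat)]]].
have mem_im (j : bounded) i v :
    (v \in values (fun x => j x : nat) (fibre i)) = (v \in map val (enum (im j i))).
  rewrite mem_values; apply/mapP/mapP => [[x + ->]|[w + ->]].
    rewrite mem_enum inE => /eqP bx.
    exists (Ordinal (leq_trans (jlt j x) (m_le _))) => //.
    by rewrite mem_enum ffunE inE; apply/existsP; exists x; rewrite /= eqxx andbT; apply/eqP.
  rewrite mem_enum ffunE inE => /existsP[x /andP[bx /eqP jx]].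
  by exists x; rewrite ?mem_enum.
have sort_enum (A : {set 'I_mm}) : sorted ltn (map val (enum A)).
  rewrite -[enum _](eq_filter (mem_enum _)).
  rewrite -(eq_filter (mem_map val_inj _)) -filter_map.
  by rewrite (sorted_filter ltn_trans) // unlock val_ord_enum iota_ltn_sorted.
have values_im (j : bounded) i :
    values (fun x => j x : nat) (fibre i) = map val (enum (im j i)).
  by apply: eq_sorted_ltn => //; first exact: values_sorted.
rewrite -cardF -(card_in_imset (f := im)); last first.
  (* Injectivity: the image of a fibre and the rank of f there determine j. *)
  move=> j j'; rewrite !inE => /fibrewise_same_orderP jf /fibrewise_same_orderP j'f jj'.
  apply/ffunP => x; apply: val_inj; rewrite /=.
  rewrite -(nth_value_rank (fun x => j x : nat) (in_fibre x)).
  rewrite -(nth_value_rank (fun x => j' x : nat) (in_fibre x)).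
  rewrite (same_order_value_rank (jf _)) // (same_order_value_rank (j'f _)) //.
  by rewrite !values_im jj'.
apply: eq_card => A; apply/imsetP/familyP => [[j + ->] i|AF].
  rewrite inE => /fibrewise_same_orderP jf; rewrite !inE; apply/andP; split.
    apply/subsetP => v; rewrite ffunE !inE => /existsP[x /andP[/eqP <- /eqP <-]].
    exact: jlt.
  by rewrite -(size_same_order_values (jf i)) values_im size_map -cardE.
(* Surjectivity: enumerate each set increasingly along the ranks of f. *)
pose s i := map val (enum (A i)).
have size_s i : size (s i) = size (values f (fibre i)).
  by have := AF i; rewrite inE => /andP[_ /eqP <-]; rewrite size_map cardE.
have rk_lt x : (value_rank f (fibre (b x)) x < size (s (b x)))%N.
  by rewrite size_s value_rank_lt.
have ex x : exists v : 'I_(M x), val v = nth 0%N (s (b x)) (value_rank f (fibre (b x)) x).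
  have /mapP[v + ->] := mem_nth 0%N (rk_lt x); rewrite mem_enum => vA.
  have := AF (b x); rewrite inE => /andP[/subsetP/(_ v vA)]; rewrite inE -ME => vM _.
  by exists (Ordinal vM).
have [j0 j0E] := fin_all_exists ex.
pose j : bounded := finfun j0.
have jE x i : x \in fibre i -> j x = nth 0%N (s i) (value_rank f (fibre i) x) :> nat.
  by rewrite mem_enum inE => /eqP <-; rewrite ffunE j0E.
exists j.
  rewrite inE; apply/fibrewise_same_orderP => i x y xi yi.
  rewrite !(jE _ i) // nth_sorted_leq ?size_s ?value_rank_lt ?sort_enum //.
  exact: value_rank_leq.
apply/ffunP => i; apply/setP => v; rewrite ffunE inE; apply/idP/existsP.
  move=> vA; have vs : val v \in s i by rewrite map_f ?mem_enum.
  have := vs; rewrite -index_mem size_s => /value_rank_onto[x xi xE].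
  exists x; move: (xi); rewrite mem_enum inE => -> /=.
  by rewrite (jE _ i) // xE nth_index.
move=> [x /andP[bx]]; rewrite (jE x i) ?mem_enum // => /eqP xv.
have : nat_of_ord v \in s i.
  by rewrite -xv mem_nth // size_s value_rank_lt // mem_enum.
by case/mapP => w; rewrite mem_enum => wA /val_inj ->.
Qed.

End FibrewiseCount.

(** * The coefficients as numbers of index functions *)

Section Multiplicity.
Variable n : nat.
Implicit Types (p s r : osp n).

Lemma osp_le_same_block r p a b : osp_le r p ->
  block_index r a = block_index r b -> block_index p a = block_index p b.
Proof.
move=> /osp_leP rp ab; apply/eqP.
by rewrite eqn_leq !rp // ab.
Qed.

(** Each block of [r] lies in exactly one block of [p], so the double product
    runs once over the blocks of [r]; a representative of a block of [r] tells
    which block of [p] contains it. *)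
Lemma prod_refined_blocks (K : comPzRingType) (F : nat -> {set 'I_n} -> K) r p
    (rep : 'I_(size r) -> 'I_n) :
    osp_le r p -> (forall l, block_index r (rep l) = l.+1) ->
  \prod_(i < size p) \prod_(P <- r | P \subset nth set0 p i) F i P =
  \prod_(l < size r) F (block_index p (rep l)).-1 (nth set0 r l).
Proof.
move=> rp repE.
transitivity (\prod_(i < size p) \prod_(l < size r | block_index p (rep l) == i.+1)
                F i (nth set0 r l)).
  apply: eq_bigr => i _; rewrite (big_nth set0) big_mkord; apply: eq_bigl => l.
  apply/subsetP/eqP => [/(_ (rep l))|pl k].
    by rewrite !mem_block // repE eqxx => /(_ isT)/eqP.
  rewrite !mem_block // -(repE l) => /eqP/(osp_le_same_block rp) ->.
  by rewrite pl.
rewrite (exchange_big_dep predT) //=; apply: eq_bigr => l _.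
rewrite (big_pred1 (Ordinal (block_index_le p (rep l)))) //.
Qed.

Lemma gammaE (K : fieldType) (t : nat -> K) s r p (rep : 'I_(size r) -> 'I_n) :
    osp_le r p -> (forall l, block_index r (rep l) = l.+1) ->
  gamma t s r p = \prod_(l < size r)
    gbinom (t (block_index p (rep l))) (size (restr s (nth set0 r l))).
Proof.
move=> rp repE; rewrite /gamma.
by rewrite (prod_refined_blocks (fun i P => gbinom (t i.+1) (size (restr s P))) rp repE).
Qed.

Lemma block_representatives r :
  exists rep : 'I_(size r) -> 'I_n, forall l, block_index r (rep l) = l.+1.
Proof. by exact: (fin_all_exists (fun l : 'I_(size r) => block_exists (ltn_ord l))). Qed.

Lemma gamma_diag (K : fieldType) (t : nat -> K) s p : gamma t s p p = beta t s p.
Proof.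
have [rep repE] := block_representatives p.
have pp : osp_le p p by apply/osp_leP.
by rewrite (gammaE t s pp repE); apply: eq_bigr => l _; rewrite repE.
Qed.

Lemma card_qmeet_preimage r p s (N : nat -> nat) (rep : 'I_(size r) -> 'I_n) :
    osp_le r p -> osp_le s r -> (forall l, block_index r (rep l) = l.+1) ->
  #|[set j : {dffun forall k : 'I_n, 'I_(N (block_index p k))} |
       qmeet r (okernel (fun k => (j k).+1)) == s]| =
  (\prod_(l < size r)
     'C(N (block_index p (rep l)), size (restr s (nth set0 r l))))%N.
Proof.
move=> rp sr repE.
pose b k : 'I_(size r) := Ordinal (block_index_le r k).
have bE k l : (b k == l) = (block_index r k == l.+1) by [].
have NE k : N (block_index p k) = N (block_index p (rep (b k))).
  by congr N; apply: (osp_le_same_block rp); rewrite repE.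
transitivity #|[set j : {dffun forall k : 'I_n, 'I_(N (block_index p k))} |
    fibrewise_ordered b (block_index s) (fun k => j k)]|.
  apply: eq_card => j; rewrite !inE.
  apply/(qmeet_okernel_eqP _ sr)/fibrewise_orderedP => [H x y bxy|H x y xy].
    by rewrite -H ?ltnS //; exact: (congr1 (fun l : 'I_(size r) => l.+1) bxy).
  by rewrite ltnS; apply: H; apply: val_inj; case: xy.
pose m l := N (block_index p (rep l)).
apply: etrans (card_fibrewise_ordered (m := m) (block_index s) NE) _.
apply: eq_bigr => l _; congr 'C(_, _); rewrite size_restr.
by congr (size (values _ _)); apply: eq_enum => k; rewrite !inE mem_block.
Qed.

(** For [N < k] both sides vanish: the product meets the factor [N - N]. *)
Lemma gbinom_nat (K : numFieldType) N k : gbinom (N%:R : K) k = 'C(N, k)%:R.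
Proof.
rewrite /gbinom; have -> : \prod_(j < k) (N%:R - j%:R) = (N ^_ k)%:R :> K.
  elim: k => [|k IH]; first by rewrite big_ord0.
  rewrite big_ord_recr /= IH ffactnSr natrM; have [kN|Nk] := leqP k N.
    by rewrite natrB.
  by rewrite ffact_small // !mul0r.
by rewrite -bin_ffact natrM mulfK // pnatr_eq0 -lt0n fact_gt0.
Qed.

(** Group the index functions by the quasi-meet of [r] with their kernel: the
    summand depends on nothing else, and [gamma] is the size of each group. *)
Lemma phi_dot_gamma (K : numFieldType) (A B : nuAlgType K) (phi : {linear A -> B})
    (S : spreadability_system phi) (X : 'I_n -> A) r p (N : nat -> nat) :
  osp_le r p ->
  phi_dot S r (fun k => N (block_index p k)) X =
  \sum_(s : osp n | osp_le s r)
    gamma (fun i => (N i)%:R : K) s r p *: phi_op S s X.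
Proof.
move=> rp; have [rep repE] := block_representatives r.
rewrite /phi_dot (partition_big
    (fun j : {dffun forall k : 'I_n, 'I_(N (block_index p k))} =>
       qmeet r (okernel (fun k => (j k).+1))) (fun s => osp_le s r)) /=; last first.
  by move=> j _; exact: qmeet_le.
apply: eq_bigr => s sr; rewrite (gammaE _ _ rp repE).
under [X in X *: _]eq_bigr => l _ do rewrite gbinom_nat.
rewrite -natr_prod -(card_qmeet_preimage _ rp sr repE) scaler_nat -sumr_const.
apply: eq_big => [j|j /eqP js]; first by rewrite inE.
by rewrite /phi_ext js.
Qed.

End Multiplicity.

(** * Polynomiality *)

Section BinomialPoly.
Variable K : numFieldType.

Definition binom_poly (k : nat) : {poly K} :=
  (k`!)%:R^-1 *: \prod_(j < k) ('X - (j%:R)%:P).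

Lemma horner_binom_poly k x : (binom_poly k).[x] = gbinom x k.
Proof.
rewrite hornerZ horner_prod mulrC; congr (_ * _).
by apply: eq_bigr => j _; rewrite hornerXsubC.
Qed.

Lemma size_binom_poly k : (size (binom_poly k) <= k.+1)%N.
Proof.
apply: leq_trans (size_scale_leq _ _) _.
by rewrite -(big_mkord xpredT (fun j => 'X - (j%:R)%:P)) size_prod_XsubC size_iota subn0.
Qed.

Lemma coef0_binom_poly k : (0 < k)%N -> (binom_poly k)`_0 = 0.
Proof.
move=> k0; rewrite -horner_coef0 horner_binom_poly -[0]/(0%:R) gbinom_nat.
by rewrite bin_small.
Qed.

End BinomialPoly.

(** Each of the [m] factors is divisible by ['X], hence the product by ['X^m]. *)
Lemma coef_prod_low (K : nzRingType) m (q : 'I_m -> {poly K}) e :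
  (forall i, (q i)`_0 = 0) -> (e < m)%N -> (\prod_(i < m) q i)`_e = 0.
Proof.
elim: m q e => // m IH q e q0 em; rewrite big_ord_recr coefM big1 // => a _.
have [ae|ea] := ltnP a m; first by rewrite IH ?mul0r.
suff -> : (e - a)%N = 0%N by rewrite q0 mulr0.
by apply/eqP; rewrite subn_eq0; apply: leq_trans ea; rewrite -ltnS.
Qed.

Section Polynomiality.
Variables (K : numFieldType) (V : lmodType K) (n : nat) (p : osp n).
Hypothesis n_gt0 : (0 < n)%N.
Variable phi : osp n -> V.

Let nblocks (s : osp n) i := size (restr s (nth set0 p i)).

Let nblocks_gt0 s (i : 'I_(size p)) : (0 < nblocks s i)%N.
Proof.
rewrite /nblocks size_restr_gt0 //; have /is_ospP[p0 _] := ospP p.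
exact: (all_nthP set0 p0).
Qed.

Let nblocks_le s i : (nblocks s i <= n)%N.
Proof.
by rewrite /nblocks size_filter (leq_trans (count_size _ _)) // size_map osp_size_le.
Qed.

(** The constant term vanishes because there is at least one block (the ground
    set being nonempty) and its factor is divisible by its variable. *)
Lemma sum_beta_vmpoly :
  exists (d : nat) (c : {ffun 'I_(size p) -> 'I_d.+1} -> V),
    c [ffun=> ord0] = 0 /\
    forall t : nat -> K,
      \sum_(s : osp n | osp_le s p) beta t s p *: phi s =
      vmpoly_eval c (fun i => t i.+1).
Proof.
exists n, (fun e : {ffun 'I_(size p) -> 'I_n.+1} => \sum_(s : osp n | osp_le s p)
  (\prod_(i < size p) (binom_poly K (nblocks s i))`_(e i)) *: phi s); split.
  apply: big1 => s _; pose i0 : 'I_(size p) := Ordinal (block_index_le p (Ordinal n_gt0)).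
  rewrite (bigD1 i0) //= [X in X * _](_ : _ = 0) ?mul0r ?scale0r //.
  rewrite ffunE; exact: (coef0_binom_poly K (nblocks_gt0 s i0)).
move=> t; rewrite /vmpoly_eval; under [RHS]eq_bigr => e _ do rewrite scaler_sumr.
rewrite [RHS]exchange_big /=; apply: eq_bigr => s _.
under [RHS]eq_bigr => e _ do rewrite scalerA -big_split /=.
rewrite -scaler_suml; congr (_ *: _).
rewrite -(bigA_distr_bigA (fun (i : 'I_(size p)) (e : 'I_n.+1) =>
  t i.+1 ^+ e * (binom_poly K (nblocks s i))`_e)).
apply: eq_bigr => i _; rewrite -horner_binom_poly (@horner_coef_wide _ n.+1).
  by apply: eq_bigr => e _; rewrite mulrC.
by apply: leq_trans (size_binom_poly _ _) _; rewrite ltnS nblocks_le.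
Qed.

(** Every block of [p] contributes a factor divisible by the variable, whence the
    lower bound [size p] on the degrees. *)
Lemma sum_beta_vpoly :
  exists (d : nat) (c : 'I_d.+1 -> V),
    (forall e : 'I_d.+1, (e < size p)%N -> c e = 0) /\
    forall t : K,
      \sum_(s : osp n | osp_le s p) beta (fun=> t) s p *: phi s = vpoly_eval c t.
Proof.
pose q s : {poly K} := \prod_(i < size p) binom_poly K (nblocks s i).
pose d := \max_s size (q s).
exists d, (fun e : 'I_d.+1 => \sum_(s : osp n | osp_le s p) (q s)`_e *: phi s); split.
  move=> e ep; apply: big1 => s _; rewrite coef_prod_low ?scale0r // => i.
  by rewrite coef0_binom_poly.
move=> t; rewrite /vpoly_eval; under [RHS]eq_bigr => e _ do rewrite scaler_sumr.
rewrite [RHS]exchange_big /=; apply: eq_bigr => s _.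
under [RHS]eq_bigr => e _ do rewrite scalerA mulrC.
rewrite -scaler_suml; congr (_ *: _).
rewrite -(@horner_coef_wide _ d.+1); last by rewrite ltnW // ltnS leq_bigmax.
by rewrite horner_prod; apply: eq_bigr => i _; rewrite horner_binom_poly.
Qed.

End Polynomiality.

(** * The sum formula and its polynomiality *)

Theorem theorem3p9 (R : realType) (A B : nuAlgType R[i]) (phi : {linear A -> B})
    (S : spreadability_system phi) (n : nat) (n_gt0 : (0 < n)%N)
    (X : 'I_n -> A) :
  (forall (rho p : osp n) (N : nat -> nat),
     osp_le rho p -> (forall i, (0 < i)%N -> (0 < N i)%N) ->
     phi_dot S rho (fun k => N (block_index p k)) X =
     \sum_(sigma : osp n | osp_le sigma rho)
       gamma (fun i => (N i)%:R : R[i]) sigma rho p *: phi_op S sigma X) /\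
  (forall p : osp n,
     (forall N : nat -> nat, (forall i, (0 < i)%N -> (0 < N i)%N) ->
        phi_dot S p (fun k => N (block_index p k)) X =
        \sum_(sigma : osp n | osp_le sigma p)
          beta (fun i => (N i)%:R : R[i]) sigma p *: phi_op S sigma X) /\
     (exists (d : nat) (c : {ffun 'I_(size p) -> 'I_d.+1} -> B),
        c [ffun=> ord0] = 0 /\
        forall N : nat -> nat, (forall i, (0 < i)%N -> (0 < N i)%N) ->
          phi_dot S p (fun k => N (block_index p k)) X =
          vmpoly_eval c (fun i => (N i.+1)%:R)) /\
     (forall N : nat, (0 < N)%N ->
        phi_dot S p (fun=> N) X =
        \sum_(sigma : osp n | osp_le sigma p)
          beta (fun=> N%:R : R[i]) sigma p *: phi_op S sigma X) /\
     (exists (d : nat) (c : 'I_d.+1 -> B),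
        (forall e : 'I_d.+1, (e < size p)%N -> c e = 0) /\
        forall N : nat, (0 < N)%N ->
          phi_dot S p (fun=> N) X = vpoly_eval c N%:R)).
Proof.
have main := @phi_dot_gamma n R[i] A B phi S X.
have diag p (N : nat -> nat) : phi_dot S p (fun k => N (block_index p k)) X =
    \sum_(sigma : osp n | osp_le sigma p)
      beta (fun i => (N i)%:R : R[i]) sigma p *: phi_op S sigma X.
  rewrite main; last by apply/osp_leP.
  by apply: eq_bigr => sigma _; rewrite gamma_diag.
split=> [rho p N rp _|p]; first exact: main.
split; first by move=> N _; exact: diag.
split.
  have [d [c [c0 cE]]] := sum_beta_vmpoly p n_gt0 (fun s => phi_op S s X).
  exists d, c; split=> // N _; rewrite diag.
  exact: (cE (fun i => (N i)%:R)).
split; first by move=> N _; exact: (diag p (fun=> N)).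
have [d [c [c0 cE]]] := sum_beta_vpoly p (fun s => phi_op S s X).
by exists d, c; split=> // N _; rewrite (diag p (fun=> N)).
Qed.
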